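(* For all integers $a\ge 1$ and $n\ge 1$, the radius of $\Pi^a_n$ is $$r(\Pi^a_n)=\left\lfloor\frac{a}{2}\right\rfloor\left\lceil\frac{n}{2}\right\rceil+\left\lceil\frac{a}{2}\right\rceil\left\lfloor\frac{n}{2}\right\rfloor .$$
   Context: For integers $a\ge 1$ and $n\ge 0$, let $\mathcal{S}^a_n$ be the set of all words $\alpha_1\cdots\alpha_n$ of length $n$ over the alphabet $\{0,1,\dots,a\}$ such that the letter $a$ appears only immediately after a letter $0$ (so $\alpha_1\ne a$, and $\alpha_i=a$ implies $\alpha_{i-1}=0$). The metallic cube $\Pi^a_n$ is the simple graph with vertex set $\mathcal{S}^a_n$ in which two vertices $\alpha,\beta$ are adjacent if and only if $\sum_{k=1}^n|\alpha_k-\beta_k|=1$, i.e. one is obtained from the other by replacing a single letter $k$ by $k+1$, $0\le k\le a-1$. For a connected graph $G$, $d(v,w)$ is the shortest-path distance, $e(v)=\max_{w\in V(G)}d(v,w)$ is the eccentricity of $v$, and the radius is $r(G)=\min_{v\in V(G)}e(v)$. *)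

(* Defs.v *)
From HB Require Import structures.
From mathcomp Require Import all_boot ssralg ssrint.
Set Implicit Arguments.
Unset Strict Implicit.
Unset Printing Implicit Defensive.

Section GraphMetric.
Variables (T : finType) (e : rel T).
Implicit Types x y v w : T.

Definition walk (k : nat) x y : bool :=
  [exists p : k.-tuple T, path e x p && (last x p == y)].

(* The least [k] such that there is a walk of length [k] from [x] to [y].
   A shortest walk is a path, so it has fewer than [#|T|] edges and the search
   below [#|T|] is exhaustive (see [distP]); when [x] and [y] are not connected,
   the value is [#|T|]. *)
Definition dist x y : nat := find (fun k => walk k x y) (iota 0 #|T|).

Definition eccentricity v : nat := \max_(w : T) dist v w.

(* The default value [#|T|] of the iterated minimum bounds every eccentricity
   (see [eccentricity_le]), so it plays no role when [T] is inhabited. *)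
Definition radius : nat := \big[minn/#|T|]_(v : T) eccentricity v.

Lemma walkP k x y :
  reflect (exists p, [/\ path e x p, last x p = y & size p = k]) (walk k x y).
Proof.
apply: (iffP existsP) => [[p /andP[pp /eqP lp]]|[p [pp lp sp]]].
  by exists p; rewrite size_tuple.
by exists (tcast sp (in_tuple p)); rewrite val_tcast pp lp /=.
Qed.

Lemma distP x y : connect e x y ->
  (exists p, [/\ path e x p, last x p = y & size p = dist x y]) /\
  (forall p, path e x p -> last x p = y -> dist x y <= size p).
Proof.
move=> cxy.
have short p : path e x p -> last x p = y ->
    exists q, [/\ path e x q, last x q = y, size q < #|T| & size q <= size p].
  move=> pp lp; case: (shortenP pp) lp => q pq uq sqp lq.
  exists q; split=> //; first by have := max_card (mem (x :: q)); rewrite (card_uniqP uq).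
  by apply: uniq_leq_size sqp; case/andP: uq.
have min p : path e x p -> last x p = y -> dist x y <= size p.
  move=> pp lp; have [q [pq lq qT le_qp]] := short p pp lp.
  apply: leq_trans le_qp; rewrite leqNgt; apply/negP => lt_q.
  have := before_find 0 lt_q; rewrite nth_iota // add0n => /negbT/walkP; case.
  by exists q.
split=> //; case/connectP: cxy => p pp lp.
have [q [pq lq qT _]] := short p pp (esym lp).
have ltd : dist x y < #|T| by apply: leq_ltn_trans (min q pq lq) qT.
have hw : has (fun k => walk k x y) (iota 0 #|T|).
  by rewrite has_find size_iota.
have := nth_find 0 hw; rewrite -/(dist x y) nth_iota // add0n.
by move=> /walkP.
Qed.

Lemma eccentricity_le v : eccentricity v <= #|T|.
Proof.
by apply/bigmax_leqP => w _; apply: leq_trans (find_size _ _) _; rewrite size_iota.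
Qed.

End GraphMetric.

Section MetallicCube.
Variables a n : nat.
Implicit Types w : n.-tuple 'I_a.+1.

Definition metallic w : bool :=
  [forall i : 'I_n, (tnth w i == ord_max) ==>
     [exists j : 'I_n, (j.+1 == i :> nat) && (tnth w j == ord0)]].

Definition metallic_word : predArgType := {w | metallic w}.
HB.instance Definition _ := Finite.on metallic_word.

(* Under [`|_|], [-] is the untruncated subtraction of [int]. *)
Definition metallic_adj : rel metallic_word := fun u v =>
  \sum_(k < n) `|tnth (val u) k - tnth (val v) k| == 1.

End MetallicCube.

Section MetallicCubeIsConnected.
Variables a n : nat.

Lemma metallic_adj_irrefl : irreflexive (@metallic_adj a n).
Proof.
by move=> u; rewrite /metallic_adj big1 // => k _; rewrite GRing.subrr.
Qed.

Lemma metallic_adj_sym : symmetric (@metallic_adj a n).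
Proof.
by move=> u v; rewrite /metallic_adj; under eq_bigr => k _ do rewrite distnC.
Qed.

Lemma metallic_zeros : 0 < a -> metallic (nseq_tuple n (@ord0 a)).
Proof.
move=> a0; apply/forallP => i; apply/implyP.
by rewrite (tnth_nth ord0) nth_nseq ltn_ord -val_eqE /= ltn_eqF.
Qed.

Lemma metallic_connect0 (a0 : 0 < a) (u : metallic_word a n) :
  connect (@metallic_adj a n) u (exist (fun w => is_true (metallic w)) _ (metallic_zeros a0)).
Proof.
have [m] := ubnP (\sum_(k < n) tnth (val u) k); elim: m u => // m IHm u le_m.
have [u0|] := boolP [forall i, tnth (val u) i == ord0].
  suff -> : u = exist (fun w => is_true (metallic w)) _ (metallic_zeros a0) by apply: connect0.
  apply/val_inj/eq_from_tnth => i /=.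
  by rewrite (eqP (forallP u0 i)) (tnth_nth ord0) nth_nseq ltn_ord.
rewrite negb_forall => /existsP[i ui0].
have ui_gt0 : 0 < tnth (val u) i by rewrite lt0n -val_eqE in ui0 *.
pose v : n.-tuple 'I_a.+1 :=
  [tuple if k == i then inord (tnth (val u) i).-1 else tnth (val u) k | k < n].
have vE k : tnth v k = if k == i then inord (tnth (val u) i).-1 else tnth (val u) k.
  by rewrite tnth_mktuple.
have vi : tnth v i = (tnth (val u) i).-1 :> nat.
  by rewrite vE eqxx inordK // (leq_ltn_trans (leq_pred _)).
have lt_v : tnth v i < tnth (val u) i by rewrite vi prednK.
have mv : metallic v.
  apply/forallP => k; apply/implyP; have [->|ki] := eqVneq k i.
    move/eqP/(congr1 val) => /= vmax.
    by move: lt_v; rewrite vmax ltnNge -ltnS ltn_ord.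
  rewrite vE (negPf ki) => uk.
  have /existsP[j /andP[jk uj]] := implyP (forallP (valP u) k) uk.
  apply/existsP; exists j; rewrite jk vE.
  by have [ji|_] := eqVneq j i; rewrite ?uj // -ji uj in ui0.
apply: (@connect_trans _ _ (exist (fun w => is_true (metallic w)) v mv)).
  apply: connect1; rewrite /metallic_adj /= (bigD1 i) //= big1 => [|k /negPf ki].
    by rewrite addn0 vi -{1}(prednK ui_gt0) distSn //= ?distnn.
  by rewrite vE ki GRing.subrr.
apply: IHm => /=; rewrite ltnS in le_m; apply: leq_trans le_m.
rewrite (bigD1 i) // [X in _ < X](bigD1 i) //= -addSn leq_add //.
by apply: leq_sum => k /negPf ki; rewrite vE ki.
Qed.

Lemma metallic_connected (a0 : 0 < a) (u v : metallic_word a n) :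
  connect (@metallic_adj a n) u v.
Proof.
apply: connect_trans (metallic_connect0 a0 u) _.
by rewrite (sym_connect_sym metallic_adj_sym) (metallic_connect0 a0 v).
Qed.

End MetallicCubeIsConnected.

(* Main.v *)
Require Import Defs.
From mathcomp Require Import all_boot.
From mathcomp Require Import ssralg ssrint.
From mathcomp Require Import zify.

(** Write b for a./2. In the metallic cube the distance between two words is
    the sum of the differences of their letters ([dist_l1]): a walk cannot be
    shorter, and lowering a single letter of a metallic word always gives a
    metallic word, so one may go down from both words to their letterwise
    minimum along shortest walks.

    The constant word bb...b is a central vertex. A letter differs from b by
    at most b, except that the letter a differs from b by b + 1 when a is odd;
    each letter a comes with a letter 0 just before it, so at most half of the
    letters are a ([count_max_letter]). This bounds the eccentricity of bb...b
    by b * n + odd a * n./2, which is the announced value.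

    Conversely, cut the positions into consecutive pairs, with the last
    position alone if n is odd. The blocks 0a and (a-1)0 are at distance 2a - 1
    from each other, so one of them is at distance at least a from any given
    block; for a lone letter, one of 0 and a-1 is at distance at least b. As
    none of these blocks starts with a, they may be freely concatenated, and
    every word has a metallic word at the required distance ([far_word]). *)

Set Implicit Arguments.
Unset Strict Implicit.
Unset Printing Implicit Defensive.

Lemma radius_eq (T : finType) (e : rel T) (c : T) (r : nat) :
    (forall w, dist e c w <= r) -> (forall v, exists w, r <= dist e v w) ->
  radius e = r.
Proof.
move=> near_c far.
have ecc_ge v : r <= eccentricity e v.
  by have [w le_r] := far v; apply: leq_trans le_r (leq_bigmax w).
apply/eqP; rewrite eqn_leq; apply/andP; split.
  have ecc_c : eccentricity e c <= r by apply/bigmax_leqP => w _; apply: near_c.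
  rewrite /radius; have := mem_index_enum c.
  elim: (index_enum T) => // x s IHs; rewrite big_cons inE geq_min.
  by case/predU1P=> [<-|/IHs ->]; rewrite ?ecc_c ?orbT.
rewrite /radius; elim/big_ind: _ => [|x y rx ry|v _] //.
  exact: leq_trans (ecc_ge c) (eccentricity_le e c).
by rewrite leq_min rx.
Qed.

Section Distance.
Variables a n : nat.
Implicit Types u v w : metallic_word a n.

Definition letter u (k : 'I_n) : nat := tnth (val u) k.

Definition l1 u v : nat := \sum_(k < n) `|letter u k - letter v k|.

Lemma letter_inj u v : letter u =1 letter v -> u = v.
Proof. by move=> uv; apply/val_inj/eq_from_tnth => k; apply/val_inj/uv. Qed.

Lemma letter_pred_max u (k : 'I_n) : letter u k = a ->
  exists2 j : 'I_n, j.+1 = k :> nat & letter u j = 0.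
Proof.
move/eqP=> uk.
have /existsP[j /andP[/eqP jk /eqP uj]] := implyP (forallP (valP u) k) uk.
by exists j; rewrite // /letter uj.
Qed.

Lemma l1_sym u v : l1 u v = l1 v u.
Proof. by apply: eq_bigr => k _; rewrite distnC. Qed.

Lemma l1_triangle u v w : l1 u w <= l1 u v + l1 v w.
Proof. by rewrite /l1 -big_split /=; apply: leq_sum => k _; lia. Qed.

Lemma l1_path u p : path (@metallic_adj a n) u p -> l1 u (last u p) <= size p.
Proof.
elim: p u => [|v p IHp] u /=; first by rewrite /l1 big1 // => k _; lia.
case/andP=> /eqP uv /IHp le_p.
apply: leq_trans (l1_triangle u v _) _.
by rewrite -add1n leq_add // /l1 uv.
Qed.

(** Lowering the letter [i] may create a letter 0 but never destroys one, nor
    does it create a letter a, so it keeps a word metallic. *)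
Lemma lower_letter u (i : 'I_n) : 0 < letter u i ->
  exists v, (letter v i).+1 = letter u i /\
            forall k, k != i -> letter v k = letter u k.
Proof.
move=> ui_gt0.
pose f (k : 'I_n) := if k == i then (letter u i).-1 else letter u k.
have f_le k : f k <= letter u k.
  by rewrite /f; case: eqP => // ->; apply: leq_pred.
pose x : n.-tuple 'I_a.+1 := [tuple inord (f k) | k < n].
have xE k : tnth x k = f k :> nat.
  rewrite tnth_mktuple inordK // (leq_ltn_trans (f_le k)) //; exact: ltn_ord.
have mx : metallic x.
  apply/forallP => k; rewrite -val_eqE /= xE; apply/implyP => /eqP fk.
  have uk : letter u k = a.
    by apply/eqP; rewrite eqn_leq -{2}fk f_le -ltnS ltn_ord.
  have [j jk uj] := letter_pred_max uk; apply/existsP; exists j.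
  by rewrite jk eqxx -val_eqE /= xE -leqn0 -uj f_le.
exists (exist (fun x => is_true (metallic x)) x mx).
by rewrite /letter; split=> [|k ki]; rewrite xE /f ?(negPf ki) // eqxx prednK.
Qed.

Lemma step_down u v (i : 'I_n) : letter v i < letter u i ->
  exists2 w, metallic_adj u w & (l1 w v).+1 = l1 u v.
Proof.
move=> vu; have [|w [wi wE]] := @lower_letter u i; first by lia.
exists w.
  change (l1 u w == 1); rewrite /l1 (bigD1 i) //=.
  by rewrite big1 => [|k ki]; [lia | rewrite wE //; lia].
rewrite /l1 (bigD1 i) //= [RHS](bigD1 i) //= -addSn.
by congr (_ + _); [lia | apply: eq_bigr => k ki; rewrite wE].
Qed.

(** Where the two words differ, the larger letter is lowered: raising the
    smaller one may leave the cube. Hence the path grows at both ends. *)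
Lemma l1_walk u v : exists p,
  [/\ path (@metallic_adj a n) u p, last u p = v & size p = l1 u v].
Proof.
have [m] := ubnP (l1 u v); elim: m u v => // m IHm u v.
have [/existsP[i uv_i] lt_m|] := boolP [exists i, letter v i < letter u i].
  have [w uw lw] := step_down uv_i.
  have [|p [pp lp sp]] := IHm w v; first by lia.
  by exists (w :: p); rewrite /= uw pp lp sp lw.
rewrite negb_exists => /forallP le_uv.
have [/existsP[i vu_i] lt_m|] := boolP [exists i, letter u i < letter v i].
  have [w vw lw] := step_down vu_i; rewrite l1_sym (l1_sym v) in lw.
  have [|p [pp lp sp]] := IHm u w; first by lia.
  exists (rcons p v); rewrite rcons_path last_rcons size_rcons pp lp sp lw.
  by rewrite metallic_adj_sym vw.
rewrite negb_exists => /forallP le_vu _; exists [::].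
have uv : u = v.
  apply: letter_inj => k; apply/eqP.
  by rewrite eqn_leq leqNgt le_uv leqNgt le_vu.
by rewrite uv /l1 big1 // => k _; lia.
Qed.

Lemma dist_l1 u v : 0 < a -> dist (@metallic_adj a n) u v = l1 u v.
Proof.
move=> a0; have [[p [pp lp sp]] min] := distP (metallic_connected a0 u v).
apply/eqP; rewrite eqn_leq; apply/andP; split.
  by have [q [pq lq <-]] := l1_walk u v; apply: min.
by have := l1_path pp; rewrite lp sp.
Qed.

(** The cyclic predecessor maps the positions of the letter a injectively to
    positions of the letter 0. *)
Lemma count_max_letter w : 0 < a -> #|[set k | letter w k == a]| <= n./2.
Proof.
move=> a0; set A := [set k | _].
have disj : [disjoint A & [set ord_pred k | k in A]].
  apply/pred0P => k /=; apply/negP => /andP[kA /imsetP[j jA kj]].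
  rewrite !inE in kA jA.
  have [i ij wi] := letter_pred_max (eqP jA).
  have ki : k = i.
    apply/val_inj; rewrite kj /= -ij.
    by have -> : (i.+1 + n).-1 = i + n by []; rewrite modnDr modn_small.
  by move: kA; rewrite ki wi; lia.
have := max_card (mem (A :|: [set ord_pred k | k in A])).
rewrite cardsU (disjoint_setI0 disj) cards0 card_ord card_imset; first by lia.
exact: ord_pred_inj.
Qed.

End Distance.

Lemma metallic_half a n : 0 < a -> metallic [tuple inord a./2 : 'I_a.+1 | _ < n].
Proof.
move=> a0; apply/forallP => k; rewrite tnth_mktuple -val_eqE /= inordK; last lia.
by apply/implyP; lia.
Qed.

(** Words are functions on nat here, so that a block can be put in front by a
    mere shift of positions. *)
Lemma far_word a n (v : nat -> nat) : 0 < a ->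
  exists w : nat -> nat,
    [/\ forall k, w k <= a, w 0 < a, forall k, w k.+1 = a -> w k = 0
      & a./2 * uphalf n + uphalf a * n./2 <= \sum_(k < n) `|v k - w k| ].
Proof.
move=> a0; elim/ltn_ind: n v => -[|[|n]] IHn v.
- by exists (fun=> 0); rewrite !muln0.
- pose x := if v 0 <= (a.-1)./2 then a.-1 else 0.
  have x_lt : x < a by rewrite /x; case: ifP; lia.
  exists (fun k => if k is 0 then x else 0).
  split=> [[|k]||k|] //=; [exact: ltnW | lia |].
  by rewrite big_ord1 /= muln1 muln0 /x; case: ifP; lia.
have [w [le_wa w0 w_max le_sum]] := IHn n (leqnSn _) (fun k => v k.+2).
(* The blocks 0a and (a-1)0 are 2a - 1 apart, so the second one is at distance
   at least a as soon as the first one is not. *)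
pose far_0a := a <= v 0 + `|v 1 - a|.
exists (fun k => match k with
  | 0 => if far_0a then 0 else a.-1
  | 1 => if far_0a then a else 0
  | k.+2 => w k end).
split=> [[|[|k]]||[|[|k]]|] //=; try by case: far_0a; lia.
  exact: w_max.
rewrite !big_ord_recl /= addnA.
apply: (@leq_trans (a + (a./2 * uphalf n + uphalf a * n./2))).
  by rewrite !mulnS; lia.
by apply: leq_add le_sum; rewrite -[bump 0 0]/(1) /far_0a; case: ifP => /=; lia.
Qed.

Theorem theorem9 (a n : nat) (ha : 1 <= a) (hn : 1 <= n) :
  radius (@metallic_adj a n) = a./2 * uphalf n + uphalf a * n./2.
Proof.
pose c : metallic_word a n :=
  exist (fun w => is_true (metallic w)) _ (metallic_half n ha).
apply: (@radius_eq _ _ c) => [w|v].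
  rewrite dist_l1 //.
  apply: (@leq_trans (\sum_(k < n) (a./2 + odd a * (letter w k == a)))).
    apply: leq_sum => k _; rewrite {1}/letter tnth_mktuple inordK; last by lia.
    have : letter w k <= a by rewrite -ltnS ltn_ord.
    by case: eqP; lia.
  rewrite big_split -big_distrr /= sum_nat_const card_ord.
  have -> : \sum_(k < n) (letter w k == a) = #|[set k | letter w k == a]|.
    by rewrite -sum1dep_card [RHS]big_mkcond; apply: eq_bigr => k _; case: eqP.
  apply: (@leq_trans (n * a./2 + odd a * n./2)).
    by rewrite leq_add2l leq_mul2l count_max_letter // orbT.
  have {1}-> : n = uphalf n + n./2 by lia.
  by rewrite (uphalf_half a) !mulnDl; lia.
have [w [le_wa w0 w_max le_sum]] :=
  far_word n (fun k => nth ord0 (val v) k) ha.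
pose x : n.-tuple 'I_a.+1 := [tuple inord (w k) | k < n].
have xE (k : 'I_n) : tnth x k = w k :> nat by rewrite tnth_mktuple inordK ?ltnS.
have mx : metallic x.
  apply/forallP => -[[|k] lt_kn]; rewrite -val_eqE /= xE /=; apply/implyP.
    by rewrite ltn_eqF.
  move/eqP/w_max => wk; apply/existsP; exists (Ordinal (ltnW lt_kn)).
  by rewrite -val_eqE /= xE wk !eqxx.
exists (exist (fun x => is_true (metallic x)) x mx); rewrite dist_l1 //.
apply: leq_trans le_sum _; apply: leq_sum => k _.
by rewrite /letter xE (tnth_nth ord0).
Qed.
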